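(* Let $p\ge 3$ be a prime and $s$ be a positive integer. Let $f_2\in\mathbb{Z}$, with $f_2\notin p^s\mathbb{Z}$ unless $f_2=0$. Write $t_2=\operatorname{ord}_p f_2$ and let $g_2$ be the integer such that $f_2=p^{t_2}g_2$ when $f_2\ne 0$, and $g_2=0$ otherwise. Assume $t_2\neq 0$. Then $$ \operatorname{opt}(p^s,f_2)= \begin{cases} \operatorname{opt}(p,0) & \text{if } t_2 \text{ is odd or } t_2=\infty,\\ \max\{\operatorname{opt}(p,0),\ \operatorname{opt}(p^{s-t_2},g_2)\} & \text{if } t_2 \text{ is even.} \end{cases} $$
   Context: For a prime $p$, $\operatorname{ord}_p n$ is the usual order (valuation) at $p$ of the integer $n$, with $\operatorname{ord}_p(0)=\infty$ ($\infty$ is neither even nor odd). For an odd integer $m\ge 3$, a polynomial $f=f_2X^2+f_1X+f_0\in\mathbb{Z}[X]$ and $N\ge 0$, the sequence $B_f^N=(f(1),\dots,f(N))$ is called a Büchi sequence modulo $m$ if each of $f(1),\dots,f(N)$ is a square modulo $m$ ($0$ counts as a square). It is called non-trivial if moreover $f$ is not the square of a polynomial modulo $m$ (i.e. there is no $\varphi\in\mathbb{Z}[X]$, of any degree, with $f\equiv\varphi^2$ in $(\mathbb{Z}/m\mathbb{Z})[X]$). For odd $m\ge 3$ and $f_1,f_2\in\mathbb{Z}$, let $\operatorname{ml}(m,f_2,f_1)$ be the maximum, over all $f_0\in\mathbb{Z}$, of the $N$ such that $B_f^N$ is a non-trivial Büchi sequence modulo $m$, where $f=f_2X^2+f_1X+f_0$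 (the value $\infty$ is allowed, and $\operatorname{ml}(m,f_2,f_1)=0$ if all such sequences are trivial). Put $\operatorname{opt}(m,f_2,f_1)=\operatorname{ml}(m,f_2,f_1)+1$, $\operatorname{ml}(m,f_2)=\max_{f_1\in\mathbb{Z}}\operatorname{ml}(m,f_2,f_1)$ and $\operatorname{opt}(m,f_2)=\operatorname{ml}(m,f_2)+1$. *)

(* Defs.v *)
From HB Require Import structures.
From mathcomp Require Import all_boot all_order all_algebra.
From mathcomp Require Import boolp classical_sets constructive_ereal.

Set Implicit Arguments.
Unset Strict Implicit.
Unset Printing Implicit Defensive.

Import Order.TTheory GRing.Theory Num.Theory.

Local Open Scope ring_scope.
Local Open Scope classical_set_scope.

(* The valuation at p; None stands for the value oo taken at 0. *)
Definition ordz (p : nat) (n : int) : option nat :=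
  if n == 0 then None else Some (logn p `|n|%N).

Definition quad (f2 f1 f0 : int) : {poly int} :=
  f2 *: 'X^2 + f1 *: 'X + f0%:P.

Definition square_mod (m : nat) (a : int) : Prop :=
  exists x : int, (a = x ^+ 2 %[mod m])%Z.

(* Congruence of polynomials is coefficientwise: this is equality of the
   images in (Z/mZ)[X].  The degree of phi is not restricted. *)
Definition poly_square_mod (m : nat) (f : {poly int}) : Prop :=
  exists phi : {poly int}, forall i : nat, (f`_i = (phi ^+ 2)`_i %[mod m])%Z.

Definition values (f : {poly int}) (N : nat) : seq int :=
  [seq f.[n%:Z] | n <- iota 1 N].

Definition buchi (m : nat) (f : {poly int}) (N : nat) : Prop :=
  forall a : int, a \in values f N -> square_mod m a.

Definition nontrivial_buchi (m : nat) (f : {poly int}) (N : nat) : Prop :=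
  buchi m f N /\ ~ poly_square_mod m f.

(* Lengths live in N u {oo}, seen inside \bar int, where every nonempty set of
   elements of N u {oo} has a supremum: its maximum if it is bounded, and +oo
   otherwise.  The first argument of supremum is its value on the empty set. *)
Definition ml3 (m : nat) (f2 f1 : int) : \bar int :=
  supremum 0%E [set v : \bar int | exists (f0 : int) (N : nat),
    nontrivial_buchi m (quad f2 f1 f0) N /\ v = (N%:Z)%:E].

Definition ml (m : nat) (f2 : int) : \bar int :=
  supremum 0%E (range (ml3 m f2)).

Definition opt (m : nat) (f2 : int) : \bar int := (ml m f2 + 1)%E.

(* Main.v *)
Require Import Defs.
From HB Require Import structures.
From mathcomp Require Import all_boot all_order all_algebra.
From mathcomp Require Import ring zify.
From mathcomp Require Import boolp classical_sets constructive_ereal.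

(* Write [f = p ^ r g] with [g] not zero modulo [p]; if [f] is not a square
   modulo [p ^ s] then [r < s].  If [r] is odd, [g] vanishes modulo [p] wherever
   [f] takes a square value, so the sequence has length at most 2, a length
   reached modulo [p] by [X - 1].  If [r] is even, dividing by [p ^ r] keeps both
   the squares and the non-triviality, with modulus [p ^ (s - r)].  When moreover
   [r < t2], the polynomial [g] is linear modulo [p], and it is non-trivial
   modulo [p]: otherwise it would be a nonzero constant square modulo [p], hence
   a square modulo [p ^ (s - r)] by Hensel's lemma in [Z[X]].
   Conversely, a linear polynomial with a non-trivial Buchi sequence modulo [p]
   of positive length takes the value 0 modulo [p] at most once along it (its
   length is less than [p], as some residue is not a square); moving the constant
   coefficient makes that value exactly 0 after [f2 X ^ 2] has been added, and
   Hensel's lemma lifts the other values. *)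

Set Implicit Arguments.
Unset Strict Implicit.
Unset Printing Implicit Defensive.

Import Order.TTheory GRing.Theory Num.Theory.

Local Open Scope ring_scope.

(** * Suprema of sets of lengths *)

(** [supremum] falls back on its default value when no least upper bound exists, so existence comes
    first: the least natural upper bound if there is one, [+oo] otherwise. *)
Lemma supremums_ereal_nat (A : set (\bar int)) :
  (A !=set0)%classic -> (forall v, A v -> exists N : nat, v = (N%:Z)%:E \/ v = +oo%E) ->
  (supremums A !=set0)%classic.
Proof.
move=> [v0 Av0] Anat.
have [[B AB]|Aunb] := pselect (exists B : nat, forall v, A v -> (v <= (B%:Z)%:E)%E).
  pose P (B : nat) := `[< forall v, A v -> (v <= (B%:Z)%:E)%E >].
  have exP : exists B, P B by exists B; apply/asboolP.
  case: (ex_minnP exP) => M /asboolP ubM minM.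
  exists (M%:Z)%:E; split => // u ubu.
  (* An element of [A] forces any upper bound to be nonnegative, so a finite one is a natural number
     and minimality of [M] applies. *)
  have [N [v0E|v0E]] := Anat _ Av0; last first.
    by have := AB _ Av0; rewrite v0E.
  have := ubu _ Av0; rewrite v0E.
  case: u ubu => [r ubu|_ _|_] //.
  rewrite lee_fin => Nr; have r0 : 0 <= r by apply: le_trans Nr.
  rewrite lee_fin; case: r r0 ubu {Nr} => // r _ ubu.
  rewrite lez_nat; apply: minM; apply/asboolP; exact: ubu.
exists +oo%E; split=> [v _|u ubu]; first exact: leey.
have [N Nv0] := Anat _ Av0.
case: u ubu => [r ubu|//|ubu].
  case: Aunb; exists `|r|%N => v Av; apply: le_trans (ubu _ Av) _.
  by rewrite lee_fin; lia.
by have := ubu _ Av0; case: Nv0 => ->.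
Qed.

Section Supremum.
Variable A : set (\bar int).
Hypothesis Anat : forall v, A v -> exists N : nat, v = (N%:Z)%:E \/ v = +oo%E.

Lemma supremum_nat_ub v : A v -> (v <= supremum 0%E A)%E.
Proof.
move=> Av; rewrite /supremum; case: eqP => [A0|_]; first by rewrite A0 in Av.
have [] := @xgetPex _ 0%E (supremums A); last by move=> + _; apply.
by apply: supremums_ereal_nat => //; exists v.
Qed.

Lemma supremum_nat_le u :
  (0 <= u)%E -> (forall v, A v -> (v <= u)%E) -> (supremum 0%E A <= u)%E.
Proof.
move=> u0 ubu; rewrite /supremum; case: eqP => // /eqP /set0P A0.
have [] := @xgetPex _ 0%E (supremums A); last by move=> _; apply.
exact: supremums_ereal_nat.
Qed.

(** Since [ml] is a supremum of suprema, the inner ones must again satisfy the hypothesis [Anat]. *)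
Lemma supremum_nat : exists N : nat,
  supremum 0%E A = (N%:Z)%:E \/ supremum 0%E A = +oo%E.
Proof.
have [[N sN]|nfin] := pselect (exists N : nat, (supremum 0%E A <= (N%:Z)%:E)%E).
  have : (0 <= supremum 0%E A)%E.
    have [->|/set0P [v Av]] := eqVneq A set0; first by rewrite supremum0.
    apply: le_trans (supremum_nat_ub Av).
    by have [M [->|->]] := Anat Av; [rewrite lee_fin|exact: leey].
  case: (supremum 0%E A) sN => [r _|//|//].
  by rewrite lee_fin; case: r => // r _; exists r; left.
exists 0%N; right; case E : (supremum 0%E A) => [r|//|].
  by case: nfin; exists `|r|%N; rewrite E lee_fin; lia.
by case: nfin; exists 0%N; rewrite E.
Qed.
End Supremum.

Lemma ml3_nat m f2 f1 : exists N : nat,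
  ml3 m f2 f1 = (N%:Z)%:E \/ ml3 m f2 f1 = +oo%E.
Proof. by apply: supremum_nat => v [f0 [N [_ ->]]]; exists N; left. Qed.

Lemma ml_ub m f2 f1 f0 N :
  nontrivial_buchi m (quad f2 f1 f0) N -> ((N%:Z)%:E <= ml m f2)%E.
Proof.
move=> fN; apply: (@le_trans _ _ (ml3 m f2 f1)).
  by apply: supremum_nat_ub => [v [h0 [M [_ ->]]]|]; [exists M; left|exists f0, N].
by apply: supremum_nat_ub => [v [h1 _ <-]|]; [exact: ml3_nat|exists f1].
Qed.

Lemma ml_le m f2 u : (0 <= u)%E ->
  (forall f1 f0 N, nontrivial_buchi m (quad f2 f1 f0) N -> ((N%:Z)%:E <= u)%E) ->
  (ml m f2 <= u)%E.
Proof.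
move=> u0 ubu; apply: supremum_nat_le => // [v [f1 _ <-]|v [f1 _ <-]].
  exact: ml3_nat.
apply: supremum_nat_le => // [v' [f0 [N [_ ->]]]|v' [f0 [N [fN ->]]]].
  by exists N; left.
exact: ubu fN.
Qed.

Lemma ml_ge0 m f2 : (0 <= ml m f2)%E.
Proof.
have [v [f1 _ <-]|N [E|E]] := @supremum_nat (range (ml3 m f2)).
- exact: ml3_nat.
- by rewrite /ml E lee_fin.
- by rewrite /ml E leey.
Qed.

(** * Squares and Buchi sequences for a general modulus *)

Lemma square_modP m a :
  square_mod m a <-> exists x q : int, a = x ^+ 2 + m%:Z * q.
Proof.
split=> [[x /eqP]|[x [q ->]]].
  rewrite eqz_mod_dvd => /dvdzP [q aq]; exists x, q; lia.
by exists x; apply/eqP; rewrite eqz_mod_dvd addrC addKr dvdz_mulr.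
Qed.

Lemma scale_polyI (c : int) : c != 0 -> injective ( *:%R c : {poly int} -> _).
Proof.
move=> c0 f g; rewrite -!mul_polyC => /mulfI; apply.
by rewrite polyC_eq0.
Qed.

Lemma poly_dvdzP (d : int) (f : {poly int}) :
  (exists q, f = d *: q) <-> (forall i, (d %| f`_i)%Z).
Proof.
split=> [[q ->] i|df]; first by rewrite coefZ dvdz_mulr.
by apply/polyOver_dvdzP; apply/polyOverP.
Qed.

Lemma poly_square_modP m f :
  poly_square_mod m f <-> exists x q : {poly int}, f = x ^+ 2 + m%:Z *: q.
Proof.
split=> [[x fx]|[x [q ->]]]; exists x.
  have [|q fq] := (poly_dvdzP m%:Z (f - x ^+ 2)).2.
    by move=> i; rewrite coefB -eqz_mod_dvd; apply/eqP.
  by exists q; rewrite -fq addrC subrK.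
by move=> i; apply/eqP; rewrite eqz_mod_dvd -coefB addrC addKr coefZ dvdz_mulr.
Qed.

Lemma buchiP m f N :
  buchi m f N <-> forall n : nat, (0 < n <= N)%N -> square_mod m f.[n%:Z].
Proof.
split=> [fN n nN|fN a /mapP [n]].
  by apply: fN; apply/mapP; exists n; rewrite // mem_iota; lia.
by rewrite mem_iota => nN ->; apply: fN; lia.
Qed.

Lemma horner_quad f2 f1 f0 x : (quad f2 f1 f0).[x] = f2 * x ^+ 2 + f1 * x + f0.
Proof. by rewrite /quad !hornerE. Qed.

Lemma scale_quad c f2 f1 f0 :
  c *: quad f2 f1 f0 = quad (c * f2) (c * f1) (c * f0).
Proof. by rewrite /quad !scalerDr !scalerA -[c *: _%:P]mul_polyC polyCM. Qed.

Lemma coef_quad f2 f1 f0 i : (quad f2 f1 f0)`_i = nth 0 [:: f0; f1; f2] i.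
Proof.
by rewrite /quad !coefE; case: i => [|[|[|i]]]; rewrite //= ?nth_nil; ring.
Qed.

Lemma nontrivial_buchi_mod (m : nat) (f g : {poly int}) N :
  (forall i, (f`_i = g`_i %[mod m])%Z) ->
  nontrivial_buchi m f N -> nontrivial_buchi m g N.
Proof.
move=> fg [fN fnt]; split; last first.
  by case=> x gx; apply: fnt; exists x => i; rewrite fg.
have [|q fgq] := (poly_dvdzP m%:Z (f - g)).2.
  by move=> i; rewrite coefB -eqz_mod_dvd; apply/eqP.
apply/buchiP => n /((buchiP _ _ _).1 fN) /square_modP [x [e fx]].
apply/square_modP; exists x, (e - q.[n%:Z]).
have := congr1 (fun h : {poly int} => h.[n%:Z]) fgq.
rewrite /= !hornerE fx => E; rewrite mulrBr -E; ring.
Qed.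

Lemma nontrivial_buchi_dvd m k f N :
  (m %| k)%N -> buchi k f N -> ~ poly_square_mod m f -> nontrivial_buchi m f N.
Proof.
move=> /dvdnP [d ->] fN ?; split=> //.
apply/buchiP => n /((buchiP _ _ _).1 fN) /square_modP [x [e ->]].
by apply/square_modP; exists x, (d%:Z * e); rewrite PoszM; ring.
Qed.

Lemma poly_square_mod_dvd m k f :
  (m %| k)%N -> poly_square_mod k f -> poly_square_mod m f.
Proof.
move=> /dvdnP [d ->] /poly_square_modP [x [q ->]].
by apply/poly_square_modP; exists x, (d%:Z *: q); rewrite scalerA PoszM mulrC.
Qed.

Lemma PoszX (m n : nat) : (m ^ n)%N%:Z = m%:Z ^+ n.
Proof. by rewrite -!natz natrX. Qed.

(* Newton iteration for the square root: [u] is an inverse of [2 c] modulo [P]. *)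
Lemma hensel_sqrt (R : comPzRingType) (P a c e u w : R) (k : nat) :
  a = c ^+ 2 + P * e -> 2 * c * u = 1 + P * w ->
  exists y z b, y = c + P * z /\ a = y ^+ 2 + P ^+ k.+1 * b.
Proof.
move=> aE cu; elim: k => [|k [y [z [b [yE ab]]]]].
  by exists c, 0, e; rewrite mulr0 addr0 expr1.
exists (y + P ^+ k.+1 * b * u), (z + P ^+ k * b * u).
exists (- (b * (w + 2 * z * u)) - P ^+ k * b ^+ 2 * u ^+ 2); split.
  by rewrite yE exprS; ring.
have yu : 2 * y * u = 1 + P * (w + 2 * z * u) by rewrite mulrDr addrA -cu yE; ring.
rewrite ab.
have -> : (y + P ^+ k.+1 * b * u) ^+ 2 =
   y ^+ 2 + P ^+ k.+1 * b * (2 * y * u) + P ^+ k.+1 * P ^+ k.+1 * b ^+ 2 * u ^+ 2 by ring.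
by rewrite yu !exprS; ring.
Qed.

(** * Lifting squares modulo an odd prime *)

Section Prime.
Variable p : nat.
Hypotheses (p_prime : prime p) (p_ge3 : (3 <= p)%N).

Lemma dvdz_primeM (a b : int) : (p %| a * b)%Z = (p %| a)%Z || (p %| b)%Z.
Proof. by rewrite !(dvdz_pcharf (pchar_Fp p_prime)) rmorphM mulf_eq0. Qed.

Lemma dvdz_primeX2 (a : int) : (p %| a ^+ 2)%Z = (p %| a)%Z.
Proof. by rewrite expr2 dvdz_primeM orbb. Qed.

Lemma ndvdz_prime2 : ~~ (p %| 2)%Z.
Proof. by apply/negP => /dvdn_leq; lia. Qed.

Lemma half_inverse_mod (c : int) :
  ~~ (p %| c)%Z -> exists u w, 2 * c * u = 1 + p%:Z * w.
Proof.
move=> pc; have /coprimezP [[u v] /= uv] : coprimez p (2 * c).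
  rewrite coprimezE prime_coprime // -[(_ %| _)%N]/(p %| 2 * c)%Z.
  by rewrite dvdz_primeM negb_or ndvdz_prime2.
by exists v, (- u); rewrite mulrC; lia.
Qed.

Lemma square_mod_lift s a : ~~ (p %| a)%Z -> square_mod p a -> square_mod (p ^ s) a.
Proof.
move=> pa /square_modP [x [e aE]].
have [|u [w uw]] := @half_inverse_mod x.
  by apply: contra pa => px; rewrite aE rpredD ?dvdz_mulr // expr2 dvdz_mulr.
have [y [z [b [_ ab]]]] := hensel_sqrt s aE uw.
(* The iteration at index [s] reaches [p ^ s.+1]; the surplus factor [p] goes into the cofactor. *)
by apply/square_modP; exists y, (p%:Z * b); rewrite ab PoszX [_ ^+ s.+1]exprSr mulrA.
Qed.

(** The starting root is a constant prime to [p], so its double stays invertible modulo [p] in Z[X]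
    and the same Newton iteration runs there. *)
Lemma poly_square_mod_lift s (f : {poly int}) (c : int) (e : {poly int}) :
  ~~ (p %| c)%Z -> f = (c ^+ 2)%:P + p%:Z *: e -> poly_square_mod (p ^ s) f.
Proof.
move=> /half_inverse_mod [u [w uw]] fE.
have aE : f = c%:P ^+ 2 + p%:Z%:P * e by rewrite -polyC_exp mul_polyC.
have cu : 2 * c%:P * u%:P = 1 + p%:Z%:P * w%:P :> {poly int}.
  by rewrite -polyCM -(polyC1 int) -polyCD -uw !polyCM (rmorph_nat polyC 2).
have [y [z [b [_ ab]]]] := hensel_sqrt s aE cu.
apply/poly_square_modP; exists y, (p%:Z *: b).
by rewrite ab scalerA PoszX -[_ ^+ s * _]exprSr -polyC_exp mul_polyC.
Qed.

(** * Linear polynomials modulo p *)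

Lemma poly_square_linear_mod f2 f1 f0 : (p %| f2)%Z ->
  poly_square_mod p (quad f2 f1 f0) <-> (p %| f1)%Z /\ square_mod p f0.
Proof.
move=> pf2; split=> [[x fx]|[pf1 [x f0x]]]; last first.
  exists x%:P => i; rewrite coef_quad -polyC_exp coefC.
  by case: i => [|[|[|i]]] //=; rewrite ?nth_nil //; apply/eqP;
    rewrite eqz_mod_dvd subr0.
split; last first.
  by exists x`_0; have := fx 0%N; rewrite coef_quad expr2 coef0M.
pose toFp := map_poly (intr : int -> 'F_p).
have E : toFp (quad 0 f1 f0) = toFp x ^+ 2.
  rewrite /toFp -rmorphXn; apply/polyP => i; rewrite !coef_map /=.
  apply/eqP; rewrite -subr_eq0 -rmorphB -(dvdz_pcharf (pchar_Fp p_prime)).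
  rewrite -eqz_mod_dvd -fx eqz_mod_dvd !coef_quad.
  by case: i => [|[|[|i]]] /=; rewrite ?subrr // sub0r rpredN.
(* Parity of degrees over the field: a square has even degree, whatever the degree of its root,
   while the left side would have degree 1. *)
rewrite (dvdz_pcharf (pchar_Fp p_prime)); apply/negP => /negP f1n0.
have /(congr1 (fun g : {poly 'F_p} => (size g).-1)) := E.
rewrite size_exp; have -> : size (toFp (quad 0 f1 f0)) = 2%N; last by lia.
rewrite /toFp /quad scale0r add0r rmorphD /= map_polyZ map_polyX map_polyC /=.
by rewrite size_polyDl size_scale ?size_polyX // ?size_polyC //; case: eqP.
Qed.

(** A choice [g] of square roots for all elements would be injective, hence onto by finiteness;
    squaring would then be injective, although 1 and -1 have the same square. *)
Lemma Fp_nonsquare : exists a : 'F_p, forall x : 'F_p, x ^+ 2 != a.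
Proof.
apply: contrapT => /forallNP allsq.
have sqrtP a : exists x : 'F_p, x ^+ 2 == a.
  by have /existsNP [x /negP/negbNE xa] := allsq a; exists x.
pose g a := xchoose (sqrtP a).
have gK : cancel g (fun x => x ^+ 2) by move=> a; apply/eqP/(xchooseP (sqrtP a)).
have /codomP [a ga] := injF_onto (can_inj gK) 1.
have /codomP [b gb] := injF_onto (can_inj gK) (-1).
have : (1 : 'F_p) = -1 by rewrite gb -(gK b) -gb sqrrN ga gK.
move=> /eqP; rewrite -subr_eq0 opprK -[_ + _]/(2%:~R).
by rewrite -(dvdz_pcharf (pchar_Fp p_prime)) (negPf ndvdz_prime2).
Qed.

Lemma buchi_linear_lt f1 f0 N :
  ~~ (p %| f1)%Z -> buchi p (quad 0 f1 f0) N -> (N < p)%N.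
Proof.
rewrite (dvdz_pcharf (pchar_Fp p_prime)) => f1n0 /buchiP fN.
rewrite ltnNge; apply/negP => pN.
have [a nsq] := Fp_nonsquare.
pose b : 'F_p := (a - f0%:~R) / f1%:~R.
(* The polynomial takes the non-square value [a] at [b]. Sequences start at index 1, so the residue
   0 is represented by [p]. *)
pose n := if (b : nat) == 0%N then p else b.
have nb : n%:R = b.
  rewrite /n; case: eqP => [b0|_]; last exact: natr_Zp.
  by rewrite (pcharf0 (pchar_Fp p_prime)); apply: val_inj.
have nN : (0 < n <= N)%N.
  rewrite /n; case: eqP => [_|]; first lia.
  by have := ltn_ord b; rewrite [X in (_ < X)%N]Fp_cast //; lia.
have /square_modP [x [e]] := fN n nN; rewrite horner_quad => E.
have /eqP[] := nsq x%:~R.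
have := congr1 (intr : int -> 'F_p) E.
rewrite mul0r add0r !rmorphD !rmorphM /= -pmulrn nb /b mulrC divfK // subrK => ->.
by rewrite -[X in _ + X * _]pmulrn (pcharf0 (pchar_Fp p_prime)) mul0r addr0.
Qed.

(** * Passing between the moduli p and p^s *)

Lemma nontrivial_buchi_lift s f2 f1 f0 N : (0 < s)%N -> (p %| f2)%Z ->
  nontrivial_buchi p (quad 0 f1 f0) N ->
  exists h1 h0, nontrivial_buchi (p ^ s) (quad f2 h1 h0) N.
Proof.
move=> s0 pf2 [/[dup] fN /buchiP fN' fnt].
have p_dvd_ps : (p %| p ^ s)%N by rewrite dvdn_exp.
have nt h1 h0 : ~~ (p %| h1)%Z -> ~ poly_square_mod (p ^ s) (quad f2 h1 h0).
  move=> ph1 /(poly_square_mod_dvd p_dvd_ps) /poly_square_linear_mod.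
  by case=> // ph1'; rewrite ph1' in ph1.
have [pf1|pf1] := boolP (p %| f1)%Z.
  (* Modulo [p] the polynomial is constant, so a single square value would make it trivial. For the
     empty sequence any non-trivial polynomial will do. *)
  have N0 : N = 0%N.
    apply/eqP; rewrite -leqn0 leqNgt; apply/negP => N0; apply: fnt.
    apply/poly_square_linear_mod; rewrite ?dvdz0 //; split => //.
    have /fN' /square_modP [x [e]] : (0 < 1 <= N)%N by [].
    rewrite horner_quad => E; case/dvdzP: pf1 => q f1E.
    apply/square_modP; exists x, (e - q).
    by move: E; rewrite f1E !mul0r; lia.
  exists 1, 0; split; first by apply/buchiP => n; lia.
  by apply: nt; apply/negP => /dvdn_leq; lia.
have Np := buchi_linear_lt pf1 fN.
(* Hensel's lemma cannot treat a value divisible by [p], so [h0] makes it exactly 0, a square for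
   every modulus. *)
have [h0 [ph0 hz]] : exists h0, (p %| h0 - f0)%Z /\
  forall n : nat, (0 < n <= N)%N -> (p %| f1 * n%:Z + f0)%Z ->
    f2 * n%:Z ^+ 2 + f1 * n%:Z + h0 = 0.
  have [[n0 [n0N pn0]]|nz] := pselect (exists n : nat,
    (0 < n <= N)%N /\ (p %| f1 * n%:Z + f0)%Z); last first.
    by exists f0; rewrite subrr dvdz0; split=> // n nN pn; case: nz; exists n.
  exists (- (f2 * n0%:Z ^+ 2 + f1 * n0%:Z)); split.
    rewrite (_ : _ - f0 = - (f2 * n0%:Z ^+ 2) - (f1 * n0%:Z + f0)); last by ring.
    by rewrite rpredB // rpredN dvdz_mulr.
  (* Two such indices differ by a multiple of [p], yet both lie between 1 and [N < p]. *)
  move=> n nN pn; suff -> : n = n0 by rewrite subrr.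
  have : (p %| f1 * (n%:Z - n0%:Z))%Z.
    rewrite (_ : _ * _ = f1 * n%:Z + f0 - (f1 * n0%:Z + f0)); last by ring.
    by rewrite rpredB.
  rewrite dvdz_primeM (negPf pf1) /= => pdn.
  by apply/eqP/negPn/negP => nn0; have := dvdn_leq _ pdn; lia.
exists f1, h0; split; last exact: nt.
apply/buchiP => n nN; rewrite horner_quad.
have [pn|pn] := boolP (p %| f1 * n%:Z + f0)%Z.
  by rewrite hz //; apply/square_modP; exists 0, 0; rewrite mulr0 expr0n.
set a := _ + h0; set b := (X in ~~ (_ %| X)%Z) in pn.
have pd : (p %| a - b)%Z.
  rewrite /a /b (_ : _ - _ = f2 * n%:Z ^+ 2 + (h0 - f0)); last by ring.
  by rewrite rpredD // dvdz_mulr.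
apply: square_mod_lift.
  by apply: contra pn => pa; rewrite -(subKr a b) rpredB.
have := fN' n nN; rewrite horner_quad mul0r add0r -/b => /square_modP [x [e bE]].
by case/dvdzP: pd => q abE; apply/square_modP; exists x, (e + q); lia.
Qed.

Lemma nontrivial_buchi_reduce s f2 f1 f0 N : (0 < s)%N -> (p %| f2)%Z ->
  ~ ((p %| f1)%Z /\ (p %| f0)%Z) ->
  nontrivial_buchi (p ^ s) (quad f2 f1 f0) N ->
  nontrivial_buchi p (quad 0 f1 f0) N.
Proof.
move=> s0 pf2 nz [fN fnt].
apply: (@nontrivial_buchi_mod _ (quad f2 f1 f0)).
  move=> i; apply/eqP; rewrite eqz_mod_dvd !coef_quad.
  by case: i => [|[|[|i]]]; rewrite /= ?nth_nil ?subrr ?subr0.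
apply: nontrivial_buchi_dvd fN _; first by rewrite dvdn_exp.
move=> /(poly_square_linear_mod _ _ pf2) [pf1 /square_modP [c [e f0E]]].
apply: fnt.
case/dvdzP: pf2 => a f2E; case/dvdzP: (pf1) => b f1E.
apply: (@poly_square_mod_lift s _ c (quad a b e)).
  (* If [p] divided [c], it would divide [f0] as well as [f1]. *)
  apply/negP => pc; apply: nz; split=> //.
  by rewrite f0E rpredD ?dvdz_mulr // expr2 dvdz_mulr.
rewrite scale_quad f0E f2E f1E /quad polyCD !(mulrC p%:Z); ring.
Qed.

(** * Removing powers of p *)

Lemma expz_dvd_sqr k (x : int) : (p%:Z ^+ k.*2 %| x ^+ 2)%Z -> (p%:Z ^+ k %| x)%Z.
Proof. by rewrite -muln2 exprM dvdz_pexp2r. Qed.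

Lemma primez_neq0 : p%:Z != 0.
Proof. by rewrite eqz_nat -lt0n prime_gt0. Qed.

(* Gauss: [(Z/p)[X]] is a domain, so [p] divides [x] as soon as it divides [x ^ 2]. *)
Lemma poly_expz_dvd_sqr k (x h : {poly int}) :
  x ^+ 2 = p%:Z ^+ k.*2 *: h -> exists y, x = p%:Z ^+ k *: y.
Proof.
elim: k x => [|k IH] x xE; first by exists x; rewrite expr0 scale1r.
have [|y xy] := (poly_dvdzP p%:Z x).2.
  move=> i; pose toFp := map_poly (intr : int -> 'F_p).
  have : toFp x ^+ 2 == 0.
    rewrite /toFp -rmorphXn /= xE map_polyZ doubleS exprS rmorphM /=.
    by rewrite -pmulrn (pcharf0 (pchar_Fp p_prime)) mul0r scale0r.
  rewrite expf_eq0 /= => /eqP /(congr1 (fun g : {poly 'F_p} => g`_i)).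
  rewrite coef_map coef0 /= => xi.
  by rewrite (dvdz_pcharf (pchar_Fp p_prime)) xi.
have [|z yz] := IH y.
  apply: (@scale_polyI (p%:Z ^+ 2)); first by rewrite expf_neq0 ?primez_neq0.
  by rewrite -exprZn -xy xE scalerA -exprD.
by exists z; rewrite xy yz scalerA -exprS.
Qed.

(** As [k.*2 <= s], the factor [p ^ k.*2] divides the modulus too, hence the square [x ^+ 2]; so
    [p ^ k] divides [x] and everything cancels. *)
Lemma square_mod_scale k s (a : int) : (k.*2 <= s)%N ->
  square_mod (p ^ s) (p%:Z ^+ k.*2 * a) <-> square_mod (p ^ (s - k.*2)) a.
Proof.
move=> ks; rewrite !square_modP !PoszX -{1}(subnKC ks) exprD.
have p2k0 : p%:Z ^+ k.*2 != 0 by rewrite expf_neq0 ?primez_neq0.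
split=> [[x [q E]]|[x [q ->]]]; last first.
  by exists (p%:Z ^+ k * x), q; rewrite exprMn -exprM muln2 mulrDr mulrA.
have /expz_dvd_sqr /dvdzP [y xE] : (p%:Z ^+ k.*2 %| x ^+ 2)%Z.
  apply/dvdzP; exists (a - p%:Z ^+ (s - k.*2) * q).
  by rewrite mulrC mulrBr E mulrA addrK.
exists y, q; apply: (mulfI p2k0).
by rewrite E xE exprMn -exprM muln2; ring.
Qed.

Lemma poly_square_mod_scale k s (f : {poly int}) : (k.*2 <= s)%N ->
  poly_square_mod (p ^ s) (p%:Z ^+ k.*2 *: f) <-> poly_square_mod (p ^ (s - k.*2)) f.
Proof.
move=> ks; rewrite !poly_square_modP !PoszX -{1}(subnKC ks) exprD.
have p2k0 : p%:Z ^+ k.*2 != 0 by rewrite expf_neq0 ?primez_neq0.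
split=> [[x [q E]]|[x [q ->]]]; last first.
  by exists (p%:Z ^+ k *: x), q; rewrite exprZn -exprM muln2 scalerDr scalerA.
have [|y xE] := @poly_expz_dvd_sqr k x (f - p%:Z ^+ (s - k.*2) *: q).
  by rewrite scalerBr E scalerA addrK.
exists y, q; apply: (scale_polyI p2k0).
by rewrite E xE exprZn -exprM muln2 scalerDr scalerA.
Qed.

Lemma nontrivial_buchi_scale k s (f : {poly int}) N : (k.*2 <= s)%N ->
  nontrivial_buchi (p ^ s) (p%:Z ^+ k.*2 *: f) N <->
  nontrivial_buchi (p ^ (s - k.*2)) f N.
Proof.
move=> ks; rewrite /nontrivial_buchi poly_square_mod_scale // !buchiP.
by split=> -[fN fnt]; split=> // n /fN; rewrite hornerZ square_mod_scale.
Qed.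

(** Stripping the even part of [p ^ r] leaves [p * a], a square modulo a power of [p] with exponent
    at least 2 because [r < s]. Its root is divisible by [p], so [p ^ 2] divides [p * a]. *)
Lemma square_mod_odd r s (a : int) : odd r -> (r < s)%N ->
  square_mod (p ^ s) (p%:Z ^+ r * a) -> (p %| a)%Z.
Proof.
move=> odd_r rs; rewrite -[r]odd_double_half odd_r add1n exprSr -mulrA.
have rE := odd_double_half r; rewrite odd_r in rE.
rewrite square_mod_scale; last by lia.
have -> : (s - r./2.*2 = (s - r./2.*2 - 2).+2)%N by lia.
move=> /square_modP [x [q]]; rewrite PoszX !exprS => E.
have /dvdzP [y xE] : (p %| x)%Z.
  rewrite -dvdz_primeX2 (_ : x ^+ 2 = p%:Z * (a - p%:Z * p%:Z ^+ (s - r./2.*2 - 2) * q)).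
    by rewrite dvdz_mulr.
  by rewrite mulrBr E; ring.
apply/dvdzP; exists (y ^+ 2 + p%:Z ^+ (s - r./2.*2 - 2) * q).
by apply: (mulfI primez_neq0); rewrite E xE; ring.
Qed.

(** * Classification of the non-trivial sequences modulo p^s *)

(** Induction on the cap [s], rather than a minimum of valuations, spares a special treatment of
    zero coefficients. *)
Lemma common_valuation s (a b c : int) :
  [/\ (p%:Z ^+ s %| a)%Z, (p%:Z ^+ s %| b)%Z & (p%:Z ^+ s %| c)%Z] \/
  exists r a' b' c', [/\ (r < s)%N,
    [/\ a = p%:Z ^+ r * a', b = p%:Z ^+ r * b' & c = p%:Z ^+ r * c'] &
    ~ [/\ (p %| a')%Z, (p %| b')%Z & (p %| c')%Z]].
Proof.
elim: s => [|s [[/dvdzP[a' aE] /dvdzP[b' bE] /dvdzP[c' cE]]|]]; first by left; rewrite !dvd1z.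
  have [[/dvdzP[a'' a'E] /dvdzP[b'' b'E] /dvdzP[c'' c'E]]|np] :=
    pselect [/\ (p %| a')%Z, (p %| b')%Z & (p %| c')%Z].
    by left; rewrite aE bE cE a'E b'E c'E -!mulrA -!exprS !dvdz_mull.
  by right; exists s, a', b', c'; split=> //; split; rewrite mulrC.
by move=> [r [a' [b' [c' [rs E np]]]]]; right; exists r, a', b', c'; split=> //; lia.
Qed.

(** Finite differences: [f(1) - 2 f(2) + f(3) = 2 a] with [p] odd, then [f(2) - f(1) = 3 a + b].
    Three values suffice, whence the bound 2 in the odd case below. *)
Lemma dvdz_quad_coefs a b c :
  (forall n : nat, (0 < n <= 3)%N -> (p %| (quad a b c).[n%:Z])%Z) ->
  [/\ (p %| a)%Z, (p %| b)%Z & (p %| c)%Z].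
Proof.
move=> pq; have := (pq 1 isT, pq 2 isT, pq 3 isT); rewrite !horner_quad => -[[p1 p2] p3].
have pa : (p %| a)%Z.
  suff : (p %| 2 * a)%Z by rewrite dvdz_primeM (negPf ndvdz_prime2).
  rewrite (_ : 2 * a = (a * 3%:Z ^+ 2 + b * 3%:Z + c) + (a * 1%:Z ^+ 2 + b * 1%:Z + c)
    - ((a * 2%:Z ^+ 2 + b * 2%:Z + c) + (a * 2%:Z ^+ 2 + b * 2%:Z + c))); last by lia.
  by rewrite rpredB // rpredD.
have pb : (p %| b)%Z.
  rewrite (_ : b = (a * 2%:Z ^+ 2 + b * 2%:Z + c) - (a * 1%:Z ^+ 2 + b * 1%:Z + c) - a * 3);
    last by lia.
  by rewrite !rpredB // dvdz_mulr.
split=> //; rewrite (_ : c = (a * 1%:Z ^+ 2 + b * 1%:Z + c) - a - b); last by lia.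
by rewrite !rpredB.
Qed.

(** The alternatives match the common power [p ^ r] of the coefficients: [r] odd; [r] even with
    [f2 / p ^ r] still divisible by [p] (possibly 0); [r] even and equal to the valuation of
    [f2]. *)
Lemma nontrivial_buchi_cases s f2 f1 f0 N :
  nontrivial_buchi (p ^ s) (quad f2 f1 f0) N ->
  [\/ (N <= 2)%N,
      exists h1 h0, nontrivial_buchi p (quad 0 h1 h0) N |
      exists k h2 h1 h0, [/\ (k.*2 < s)%N, f2 = p%:Z ^+ k.*2 * h2, ~~ (p %| h2)%Z &
        nontrivial_buchi (p ^ (s - k.*2)) (quad h2 h1 h0) N]].
Proof.
have [[pf2 pf1 pf0] [_ []]|] := common_valuation s f2 f1 f0.
  (* All coefficients vanish modulo [p ^ s], so the polynomial is the square of 0. *)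
  exists 0 => i; apply/eqP; rewrite eqz_mod_dvd expr0n coef0 subr0 PoszX coef_quad.
  by case: i => [|[|[|i]]]; rewrite /= ?nth_nil.
move=> [r [h2 [h1 [h0 [rs [f2E -> ->] nz]]]]]; rewrite {1}f2E -scale_quad => hN.
have [odd_r|even_r] := boolP (odd r).
  constructor 1; rewrite leqNgt; apply/negP => N2; apply: nz.
  apply: dvdz_quad_coefs => n n3; apply: (square_mod_odd odd_r rs).
  by rewrite -hornerZ; apply: (buchiP _ _ _).1 hN.1 _ _; lia.
have rE : r = r./2.*2 by rewrite even_halfK.
rewrite rE in f2E rs hN *.
have := hN; rewrite nontrivial_buchi_scale; last exact: ltnW.
have [ph2|ph2] := boolP (p %| h2)%Z => hN'; last first.
  by constructor 3; exists r./2, h2, h1, h0.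
constructor 2; exists h1, h0; apply: nontrivial_buchi_reduce hN' => //.
  by rewrite subn_gt0.
by case=> ph1 ph0; apply: nz.
Qed.

(** * Comparison of the maximal lengths *)

(** Absorbs the sequences of length at most 2 into [ml p 0]. *)
Lemma ml_p0_ge2 : (2%:E <= ml p 0)%E.
Proof.
apply: (@ml_ub p 0 1 (- 1) 2); split.
  apply/buchiP => n nN; rewrite horner_quad.
  (* The values of [X - 1] at 1 and 2 are 0 and 1, each equal to its own square. *)
  by apply/square_modP; exists (n%:Z - 1), 0; case: n nN => [|[|[|n]]] // _; lia.
by move=> /(poly_square_linear_mod _ _ (dvdz0 _)) [/dvdn_leq]; lia.
Qed.

Lemma ml_p0_le s f2 : (0 < s)%N -> (p %| f2)%Z -> (ml p 0 <= ml (p ^ s) f2)%E.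
Proof.
move=> s0 pf2; apply: ml_le (ml_ge0 _ _) _ => f1 f0 N fN.
have [h1 [h0 hN]] := nontrivial_buchi_lift s0 pf2 fN; exact: ml_ub hN.
Qed.

End Prime.

Theorem theorem2p2 (p s : nat) (f2 g2 : int) (t2 : option nat)
  (p_prime : prime p) (p_ge3 : (3 <= p)%N) (s_gt0 : (0 < s)%N)
  (f2_ndvd : f2 <> 0 -> ~ ((p ^ s)%N %| f2)%Z)
  (t2_def : t2 = ordz p f2)
  (g2_def : if t2 is Some t then f2 = (p ^ t)%N%:Z * g2 else g2 = 0)
  (t2_neq0 : t2 <> Some 0%N) :
  opt (p ^ s) f2 =
    match t2 with
    | None => opt p 0
    | Some t =>
        if odd t then opt p 0
        else Order.max (opt p 0) (opt (p ^ (s - t)) g2)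
    end.
Proof.
have [E|f2n0] := eqVneq f2 0.
  rewrite t2_def /ordz E eqxx /opt; congr (_ + _)%E.
  apply/le_anti; rewrite ml_p0_le ?dvdz0 // andbT.
  apply: ml_le (ml_ge0 _ _) _ => f1 f0 N /(nontrivial_buchi_cases p_prime p_ge3) [N2||].
  - by apply: le_trans (ml_p0_ge2 p_prime p_ge3); rewrite lee_fin lez_nat.
  - by move=> [h1 [h0 hN]]; exact: ml_ub hN.
  (* Here [f2 = 0] forces [h2 = 0], which [p] divides. *)
  - move=> [k [h2 [h1 [h0 [_ /esym/eqP]]]]].
    by rewrite mulf_eq0 expf_eq0 (negPf (primez_neq0 p_prime)) andbF => /eqP ->; rewrite dvdz0.
move: t2_def; rewrite /ordz (negPf f2n0) => t2_def.
case: t2 t2_def g2_def t2_neq0 => [t|//] [tE] f2E t0.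
have {}t0 : (0 < t)%N by rewrite lt0n; apply/eqP => E; apply: t0; rewrite E.
rewrite PoszX in f2E.
have pf2 : (p %| f2)%Z.
  by rewrite f2E -(prednK t0) exprS -mulrA dvdz_mulr.
have ts : (t < s)%N.
  rewrite ltnNge; apply/negP => st; apply: f2_ndvd; first exact/eqP.
  by rewrite PoszX f2E dvdz_mulr // dvdz_exp2l.
have lower := ml_p0_le p_prime p_ge3 s_gt0 pf2.
(* The bound [u] is left free to serve both parities: [ml p 0] for odd [t], the larger of the two
   lengths for even [t]. *)
have upper u : (ml p 0 <= u)%E ->
    (~~ odd t -> (ml (p ^ (s - t)) g2 <= u)%E) -> (ml (p ^ s) f2 <= u)%E.
  move=> pu gu; apply: ml_le => [|f1 f0 N].
    exact: le_trans (ml_ge0 _ _) pu.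
  move=> /(nontrivial_buchi_cases p_prime p_ge3) [N2||].
  - apply: le_trans pu; apply: le_trans (ml_p0_ge2 p_prime p_ge3).
    by rewrite lee_fin lez_nat.
  - by move=> [h1 [h0 hN]]; apply: le_trans pu; exact: ml_ub hN.
  - move=> [k [h2 [h1 [h0 [ks f2E' ph2 hN]]]]].
    (* As [p] does not divide [h2], the whole valuation of [f2] sits in the factor [p ^ k.*2]. *)
    have tk : t = k.*2.
      rewrite tE f2E' abszM abszX absz_nat lognM ?expn_gt0 ?(prime_gt0 p_prime) //; last first.
        by rewrite absz_gt0; apply: contra ph2 => /eqP ->; rewrite dvdz0.
      rewrite pfactorK // [logn p `|h2|]lognE.
      by move: ph2; rewrite dvdzE /= => /negPf ->; rewrite !andbF addn0.
    have h2E : h2 = g2.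
      apply: (@mulfI _ (p%:Z ^+ t)); first by rewrite expf_neq0 ?primez_neq0.
      by rewrite -f2E f2E' tk.
    rewrite h2E -tk in hN; apply: le_trans (ml_ub hN) _; apply: gu.
    by rewrite tk odd_double.
case: ifP => [odd_t|/negbT even_t]; rewrite /opt.
  by congr (_ + _)%E; apply/le_anti; rewrite lower upper ?odd_t.
have lower' : (ml (p ^ (s - t)) g2 <= ml (p ^ s) f2)%E.
  apply: ml_le (ml_ge0 _ _) _ => f1 f0 N.
  have tE2 : t = t./2.*2 by rewrite even_halfK.
  rewrite {1}tE2 -(nontrivial_buchi_scale p_prime) -?tE2; last exact: ltnW.
  by rewrite scale_quad -f2E => /ml_ub.
apply/le_anti; rewrite ge_max !leeD2r // andbT.
have [le_pg|/ltW le_gp] := leP (ml p 0) (ml (p ^ (s - t)) g2).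
  by rewrite le_max (@leeD2r _ _ _ (ml (p ^ (s - t)) g2)) ?orbT // upper.
by rewrite le_max (@leeD2r _ _ _ (ml p 0)) // upper.
Qed.
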